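(* Let $K$ be an infinite field, $n\ge 2$, $R=K[x_0,x_1,\dots,x_n]$ with the standard grading, and let $f_1,\dots,f_n\in R$ be a regular sequence of homogeneous forms of degrees $\ell_1,\dots,\ell_n\ge 1$. Let $\tilde\Omega=(f_if_j : 1\le i<j\le n)\subseteq R$. Then $\tilde\Omega$ has a graded free resolution $$0\to F_{n-2}\to F_{n-3}\to\cdots\to F_1\to F_0\to\tilde\Omega\to 0$$ with $$F_h=\bigoplus_{1\le i_1<i_2<\dots<i_{h+2}\le n} R^{\,h+1}(-\ell_{i_1}-\ell_{i_2}-\cdots-\ell_{i_{h+2}}),\qquad 0\le h\le n-2$$ (so in particular $F_0=\bigoplus_{i_1<i_2}R(-\ell_{i_1}-\ell_{i_2})$ and $F_{n-2}=R^{n-1}(-\ell_1-\cdots-\ell_n)$). This resolution is obtained by the iterated mapping cone procedure described in the context, which also gives the maps of the resolution: at each step the maps are given by the block matrices $$M_{\gamma_i}=\begin{pmatrix}-M_{\delta_{i-1}}&0\\ M_{\alpha_{i-1}}&M_{\varphi_i}\end{pmatrix},\quad i\ge1.$$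
   Context: Iterated mapping cone procedure. Start from the ideal $(f_{n-1}f_n)$ with resolution $0\to R(-\ell_{n-1}-\ell_n)\to (f_{n-1}f_n)\to 0$. For $k=n-2,n-3,\dots,1$ in this order, and, for each $k$, for $j=n,n-1,\dots,k+1$ in this order, add the generator $g=f_kf_j$ to the ideal $I'$ generated by the products already considered, namely $I'=(f_kf_{j+1},\dots,f_kf_n)+(f_af_b: k+1\le a<b\le n)$. One has $(I':g)=(f_{k+1},\dots,\widehat{f_j},\dots,f_n)$, a complete intersection, which is resolved by its minimal free (Koszul) resolution $\cdots\to E_1\xrightarrow{\delta_1}E_0\xrightarrow{\delta_0}(I':g)\to0$. Let $\cdots\to F'_1\xrightarrow{\varphi_1}F'_0\xrightarrow{\varphi_0}I'\to0$ be the resolution of $I'$ already constructed. Multiplication by $g$, as a map $R(-\deg g)\to R$, lifts to a map of complexes with degree-$0$ components $\alpha_i:E_i(-\deg g)\to F'_i$, i.e. $\varphi_0\alpha_0=g\,\delta_0$ and $\varphi_i\alpha_i=\alpha_{i-1}\delta_i$ for $i\ge1$. The mapping cone is the resolution of $(g)+I'$ with modules $R(-\deg g)\oplus F'_0$ in position $0$ and $E_{i-1}(-\deg g)\oplus F'_i$ in position $i\ge1$, with $\gamma_0$ given by the generators of $(g)+I'$ ($g$ first), and with $\gamma_i(a,b)=(-\delta_{i-1}(a),\ \alpha_{i-1}(a)+\varphi_i(b))$ for $i\ge1$. Here $M_\psi$ denotes the matrix of a map $\psi$ of free modules with respect to the canonical bases, and $\widehat{\ }$ denotes omission. *)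

(* Defs.v *)
From HB Require Import structures.
From mathcomp Require Import all_boot all_order all_algebra.
From mathcomp.multinomials Require Export mpoly.

Set Implicit Arguments.
Unset Strict Implicit.
Unset Printing Implicit Defensive.

Import GRing.Theory.
Local Open Scope ring_scope.

Definition infinite_type (T : eqType) : Prop :=
  forall s : seq T, exists x, x \notin s.

Section Ideals.
Variable R : comNzRingType.

Definition ideal_of (s : seq R) (p : R) : Prop :=
  exists c : 'I_(size s) -> R, p = \sum_(i < size s) c i * s`_i.

Definition colon_ideal (I : R -> Prop) (g p : R) : Prop := I (p * g).

Definition regular_sequence (s : seq R) : Prop :=
  (forall i, (i < size s)%N -> forall p,
     ideal_of (take i s) (p * s`_i) -> ideal_of (take i s) p)
  /\ ~ ideal_of s 1.

End Ideals.

Section GradedComplexes.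
Variables (K : fieldType) (m : nat).
Local Notation R := {mpoly K[m]}.

(* A graded free module with a homogeneous basis, R(-d_1) + ... + R(-d_r), is
   given by its rank r and the row vector of its shifts d_1, ..., d_r.  A map
   is given by its matrix in the canonical bases acting on column vectors, so
   that a map from a module of rank r to one of rank r' is an r' x r matrix.

   [gcomplex] is a sequence ... -> F_1 -> F_0 -> R: [aug] is the matrix of
   F_0 -> R and [dif i] that of F_(i+1) -> F_i. *)
Record gcomplex := GComplex {
  rk : nat -> nat;
  dg : forall i, 'rV[nat]_(rk i);
  aug : 'M[R]_(1, rk 0);
  dif : forall i, 'M[R]_(rk i, rk i.+1) }.

(* The map with matrix [A], from the module with shifts [d] to the module with
   shifts [d'], is homogeneous of degree 0. *)
Definition graded_mx r' r (d' : 'rV[nat]_r') (d : 'rV[nat]_r)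
    (A : 'M[R]_(r', r)) : Prop :=
  forall a b, A a b != 0 ->
    (d' ord0 a <= d ord0 b)%N /\ A a b \is (d ord0 b - d' ord0 a)%N.-homog.

Definition graded_free_resolution (F : gcomplex) (I : R -> Prop) : Prop :=
  [/\ graded_mx (const_mx 0%N) (dg F 0) (aug F),
      forall i, graded_mx (dg F i) (dg F i.+1) (dif F i),
      forall p : R, I p <-> exists v : 'cV_(rk F 0), aug F *m v = p%:M,
      forall v : 'cV_(rk F 0),
        aug F *m v = 0 <-> exists w : 'cV_(rk F 1), v = dif F 0 *m w
    & forall i (v : 'cV_(rk F i.+1)),
        dif F i *m v = 0 <-> exists w : 'cV_(rk F i.+2), v = dif F i.+1 *m w].

(* The differentials have entries in the irrelevant maximal ideal. *)
Definition minimal_complex (F : gcomplex) : Prop :=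
  forall i a b, (dif F i a b)@_0%MM = 0.

Definition zero_complex : gcomplex :=
  @GComplex (fun=> 0%N) (fun=> const_mx 0%N) 0 (fun=> 0).

(* The complex R(-d) -> R whose only matrix is (g). *)
Definition principal_complex (g : R) (d : nat) : gcomplex :=
  @GComplex (fun i => if i is 0 then 1%N else 0%N) (fun=> const_mx d) g%:M
    (fun=> 0).

(* [alpha] is a lifting, to a map of complexes from E(-d) to F homogeneous of
   degree 0, of the multiplication by [g] from R(-d) to R. *)
Definition lifting (g : R) (d : nat) (E F : gcomplex)
    (alpha : forall i, 'M[R]_(rk F i, rk E i)) : Prop :=
  [/\ aug F *m alpha 0%N = g *: aug E,
      forall i, dif F i *m alpha i.+1 = alpha i *m dif E i
    & forall i, graded_mx (dg F i) (map_mx (addn d) (dg E i)) (alpha i)].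

Section Cone.
Variables (g : R) (d : nat) (E F : gcomplex).
Variable alpha : forall i, 'M[R]_(rk F i, rk E i).

Definition cone_rk (i : nat) : nat :=
  if i is i'.+1 then (rk E i' + rk F i'.+1)%N else (1 + rk F 0)%N.

Definition cone_dg (i : nat) : 'rV[nat]_(cone_rk i) :=
  match i return 'rV[nat]_(cone_rk i) with
  | 0 => row_mx (const_mx d) (dg F 0)
  | i'.+1 => row_mx (map_mx (addn d) (dg E i')) (dg F i'.+1)
  end.

Definition cone_dif (i : nat) : 'M[R]_(cone_rk i, cone_rk i.+1) :=
  match i return 'M[R]_(cone_rk i, cone_rk i.+1) with
  | 0 => block_mx (- aug E) 0 (alpha 0) (dif F 0)
  | i'.+1 => block_mx (- dif E i') 0 (alpha i'.+1) (dif F i'.+1)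
  end.

Definition mapping_cone : gcomplex :=
  @GComplex cone_rk cone_dg (row_mx g%:M (aug F)) cone_dif.

End Cone.

(* The Koszul complex of a sequence of forms, each paired with its degree,
   truncated so that position i is the (i+1)-st exterior power.  It is built as
   a tensor product: K(f, s) is the mapping cone of the multiplication by f
   on K(s). *)
Fixpoint koszul (s : seq (R * nat)) : gcomplex :=
  if s is (f, d) :: s' then
    let E := koszul s' in @mapping_cone f d E E (fun=> f%:M)
  else zero_complex.

End GradedComplexes.

Section IteratedCone.
Variables (K : fieldType) (m n : nat).
Variables (f : 'I_n -> {mpoly K[m]}) (l : 'I_n -> nat).

(* The pairs (k, j) with k < j, by decreasing k and, for each k, by
   decreasing j. *)
Definition steps : seq ('I_n * 'I_n) :=
  [seq (k, j) | k : 'I_n <- rev (enum 'I_n),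
                j : 'I_n <- rev [seq j : 'I_n <- enum 'I_n | (k < j)%N]].

Definition products (s : seq ('I_n * 'I_n)) : seq {mpoly K[m]} :=
  [seq f p.1 * f p.2 | p <- s].

Definition colon_indices (k j : 'I_n) : seq 'I_n :=
  [seq i : 'I_n <- enum 'I_n | (k < i)%N && (i != j)].

Definition colon_koszul (k j : 'I_n) : gcomplex K m :=
  koszul [seq (f i, l i) | i <- colon_indices k j].

(* [iterated_cone s F]: F is obtained by adding successively the products
   f_k f_j for (k, j) in [s], with some choice of the liftings. *)
Inductive iterated_cone : seq ('I_n * 'I_n) -> gcomplex K m -> Prop :=
| iterated_cone_start k j :
    iterated_cone [:: (k, j)] (principal_complex (f k * f j) (l k + l j))
| iterated_cone_step s k j F
    (alpha : forall i, 'M_(rk F i, rk (colon_koszul k j) i)) :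
    iterated_cone s F ->
    lifting (f k * f j) (l k + l j) alpha ->
    iterated_cone (rcons s (k, j))
      (mapping_cone (f k * f j) (l k + l j) alpha).

(* The shifts of the direct sum, over i_1 < ... < i_(h+2), of
   R^(h+1)(-l_(i_1) - ... - l_(i_(h+2))). *)
Definition expected_shifts (h : nat) : seq nat :=
  flatten [seq nseq h.+1 (\sum_(i in A) l i)%N
          | A : {set 'I_n} in [pred A : {set 'I_n} | #|A| == h.+2]].

Definition shifts (F : gcomplex K m) (h : nat) : seq nat :=
  [seq dg F h 0 a | a : 'I_(rk F h)].

End IteratedCone.

(* Main.v *)
Require Import Defs.
From mathcomp Require Import all_boot all_order all_algebra.
From mathcomp Require Import zify ring.
From Stdlib Require Import IndefiniteDescription.

(** The procedure works because every colon ideal that it meets is generated by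
   a subset of the forms, and every subset of the forms is a regular sequence.

   Since the $f_i$ are homogeneous of positive degree, the regularity of
   $f_1, \dots, f_n$ in the given order implies that each $f_b$ is a
   nonzerodivisor modulo the ideal generated by any set of other forms
   ([homog_regular_nonzerodivisor]); this is a graded Nakayama argument.

   Let $g = f_kf_j$, let $I'$ be generated by the earlier products, and let $C$ be
   the ideal of the $f_i$ with $i > k$, $i \ne j$.  Each earlier product has a
   factor in $C$, so $I' \subseteq C$; and $f_k$ and $f_j$ are nonzerodivisors modulo
   $C$, so $pg \in I'$ forces $p \in C$.  Conversely $f_ig$ is a multiple of an
   earlier product for each generator $f_i$ of $C$.  Hence $(I' : g) = C$
   ([colon_products]).

   If $F$ resolves $I'$ and $E$ resolves $(I' : g)$, the mapping cone of a lifting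
   of the multiplication by $g$ resolves $I' + (g)$
   ([mapping_cone_resolution]).  The Koszul complex is itself an iterated mapping
   cone, so this lemma gives both its exactness ([koszul_resolution]) and, by
   induction along the procedure, that of the final complex
   ([iterated_cone_resolution]).  Liftings exist by the graded comparison theorem
   ([lifting_exists]).

   The shifts do not depend on the liftings: the step $(k, j)$ contributes in
   position $h$ one summand for each $h$-subset $S$ of the colon set, with shift
   the sum of the degrees over $A = S \cup \{k, j\}$.  Here $k = \min A$, and $j$ can
   be any of the $h + 1$ other elements of the $(h+2)$-set $A$, whence the exponent
   $h + 1$ ([sum_colon_subset_count]). *)

Set Implicit Arguments.
Unset Strict Implicit.
Unset Printing Implicit Defensive.

Import GRing.Theory.
Local Open Scope ring_scope.

(** * Ideals generated by a finite family *)

Section GeneratedIdeal.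
Variables (R : comNzRingType) (I : finType) (f : I -> R).
Implicit Types (A B : {set I}) (p q : R).

Definition gen_ideal A p : Prop := exists c : I -> R, p = \sum_(i in A) c i * f i.

Lemma gen_ideal0 A : gen_ideal A 0.
Proof. by exists (fun=> 0); rewrite big1 // => i _; rewrite mul0r. Qed.

Lemma gen_idealD A p q : gen_ideal A p -> gen_ideal A q -> gen_ideal A (p + q).
Proof.
move=> [c ->] [e ->]; exists (fun i => c i + e i).
by rewrite -big_split; apply: eq_bigr => i _; rewrite mulrDl.
Qed.

Lemma gen_idealM A p q : gen_ideal A q -> gen_ideal A (p * q).
Proof.
move=> [c ->]; exists (fun i => p * c i).
by rewrite mulr_sumr; apply: eq_bigr => i _; rewrite mulrA.
Qed.

Lemma gen_idealN A p : gen_ideal A p -> gen_ideal A (- p).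
Proof. by rewrite -mulN1r; apply: gen_idealM. Qed.

Lemma gen_idealB A p q : gen_ideal A p -> gen_ideal A q -> gen_ideal A (p - q).
Proof. by move=> Ap Aq; apply/gen_idealD/gen_idealN. Qed.

Lemma gen_ideal_gen A i : i \in A -> gen_ideal A (f i).
Proof.
move=> Ai; exists (fun j => (j == i)%:R).
rewrite (bigD1 i) //= eqxx mul1r big1 ?addr0 // => j /andP[_ /negPf->].
by rewrite mul0r.
Qed.

Lemma gen_ideal_sum A (J : Type) (r : seq J) (P : pred J) (F : J -> R) :
  (forall j, P j -> gen_ideal A (F j)) -> gen_ideal A (\sum_(j <- r | P j) F j).
Proof.
by move=> AF; apply: big_ind => //; [apply: gen_ideal0 | apply: gen_idealD].
Qed.

Lemma gen_idealS A B p : A \subset B -> gen_ideal A p -> gen_ideal B p.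
Proof.
move/subsetP=> sAB [c ->]; apply: gen_ideal_sum => i Ai.
exact/gen_idealM/gen_ideal_gen/sAB.
Qed.

Lemma gen_idealU1 A a p :
  gen_ideal (a |: A) p <-> exists c q, gen_ideal A q /\ p = c * f a + q.
Proof.
split=> [[c ->] | [c [q [Aq ->]]]].
  case: (boolP (a \in A)) => Aa.
    exists 0, (\sum_(i in a |: A) c i * f i); rewrite mul0r add0r; split=> //.
    by rewrite (setUidPr _) ?sub1set //; exists c.
  by exists (c a), (\sum_(i in A) c i * f i); rewrite big_setU1 //; split=> //; exists c.
apply: gen_idealD; first by apply/gen_idealM/gen_ideal_gen; rewrite setU11.
by apply: gen_idealS Aq; apply: subsetUr.
Qed.

Lemma ideal_ofE (s : seq I) A p :
  s =i A -> ideal_of [seq f i | i <- s] p <-> gen_ideal A p.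
Proof.
move=> sA; split=> [[c ->] | [c ->]].
  apply: gen_ideal_sum => i _; apply: gen_idealM.
  have /mapP[j sj ->] : [seq f i | i <- s]`_i \in [seq f i | i <- s].
    exact: mem_nth.
  by apply: gen_ideal_gen; rewrite -sA.
have lt_idx j : j \in A -> (index j s < size [seq f i | i <- s])%N.
  by rewrite size_map index_mem sA.
(* s may have repetitions: c i is placed at the first occurrence of i *)
exists (fun j => \sum_(i in A | index i s == val j) c i).
under [RHS]eq_bigr do rewrite mulr_suml.
rewrite (exchange_big_dep (mem A)) /=; last by move=> j i _ /andP[].
apply: eq_bigr => i Ai; rewrite (big_pred1 (Ordinal (lt_idx i Ai))) => [|j].
  by rewrite /= (nth_map i) ?index_mem ?sA // nth_index ?sA.
by rewrite /= Ai /= eq_sym.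
Qed.

Definition nonzerodivisor_mod A b : Prop :=
  forall p, gen_ideal A (p * f b) -> gen_ideal A p.

(** From a relation $pa = \alpha + qb$ one gets $q \in A + (a)$, and then
   subtracts a multiple of $b$ from $p$ to cancel $q$. *)
Lemma nonzerodivisor_swap A a b :
  nonzerodivisor_mod A a -> nonzerodivisor_mod (a |: A) b ->
  nonzerodivisor_mod (b |: A) a.
Proof.
move=> Aa Ab p /gen_idealU1[q [r [Ar Dpa]]].
have /Ab/gen_idealU1[c [t [At Dq]]] : gen_ideal (a |: A) (q * f b).
  by apply/gen_idealU1; exists p, (- r); split; [apply: gen_idealN | rewrite Dpa; ring].
apply/gen_idealU1; exists c, (p - c * f b); split; last by ring.
apply: Aa; rewrite mulrBl Dpa Dq.
have -> : (c * f a + t) * f b + r - c * f b * f a = f b * t + r by ring.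
by apply: gen_idealD => //; apply: gen_idealM.
Qed.

End GeneratedIdeal.

(** * Homogeneous regular sequences *)

Section Homogeneous.
Variables (K : fieldType) (m : nat).
Local Notation R := {mpoly K[m]}.

Lemma pihomog_mulr d e (p q : R) : q \is e.-homog ->
  pihomog mdeg d (p * q) = if (e <= d)%N then pihomog mdeg (d - e) p * q else 0.
Proof.
move=> hq.
have summand k : pihomog mdeg d (pihomog mdeg k p * q)
    = if (k + e == d)%N then pihomog mdeg k p * q else 0.
  have hk : pihomog mdeg k p * q \is (k + e).-homog by rewrite dhomogM ?pihomogP.
  by case: eqP => [<-|/eqP ne]; [apply: pihomog_dE | apply: pihomog_ne0 hk].
have [ed|lt_de] := leqP e d.
  pose N := maxn (mmeasure mdeg p) (d - e).+1.
  rewrite {1}(pihomog_partitionE (k := N) (mf := mdeg) (p := p)) ?leq_maxl //.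
  rewrite mulr_suml raddf_sum (eq_bigr _ (fun (k : 'I_N) _ => summand k)) -big_mkcond.
  have lt_N : (d - e < N)%N by rewrite leq_maxr.
  rewrite (big_pred1 (Ordinal lt_N)) // => k.
  by rewrite /= -val_eqE /=; apply/eqP/eqP; lia.
rewrite {1}(pihomog_partitionE (k := mmeasure mdeg p) (mf := mdeg) (p := p)) //.
rewrite mulr_suml raddf_sum big1 // => k _.
by rewrite /= summand; case: eqP => //; lia.
Qed.

Variables (I : finType) (f : I -> R) (l : I -> nat).
Hypothesis hom_f : forall i, f i \is (l i).-homog.

Lemma gen_ideal_pihomog A d p : gen_ideal f A p -> gen_ideal f A (pihomog mdeg d p).
Proof.
move=> [c ->]; rewrite raddf_sum; apply: gen_ideal_sum => i Ai.
rewrite /= (pihomog_mulr _ _ (hom_f i)); case: ifP => _; last exact: gen_ideal0.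
exact/gen_idealM/gen_ideal_gen.
Qed.

Lemma gen_ideal_of_pihomog A p :
  (forall d, gen_ideal f A (pihomog mdeg d p)) -> gen_ideal f A p.
Proof.
move=> Ap; rewrite (pihomog_partitionE (mf := mdeg) (p := p) (leqnn _)).
by apply: gen_ideal_sum => k _.
Qed.

Hypothesis l_gt0 : forall i, (0 < l i)%N.

(** Dropping $a$ from the modulus is where the grading enters.  If $N$ is the
   annihilator of $b$ in $R/A$, then regularity of $a, b$ gives $N = aN$, so that
   $N = 0$ by the graded Nakayama lemma; concretely a homogeneous element of $N$
   is $a$ times an element of $N$ of smaller degree. *)
Lemma nonzerodivisor_drop A a b :
  nonzerodivisor_mod f A a -> nonzerodivisor_mod f (a |: A) b ->
  nonzerodivisor_mod f A b.
Proof.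
move=> Aa Ab.
have homog_case d p : p \is d.-homog -> gen_ideal f A (p * f b) -> gen_ideal f A p.
  elim/ltn_ind: d p => d IHd p hp Apb.
  have /Ab/gen_idealU1[c [q [Aq Dp]]] : gen_ideal f (a |: A) (p * f b).
    by apply: gen_idealS Apb; apply: subsetUr.
  have Acb : gen_ideal f A (c * f b).
    apply: Aa; have -> : c * f b * f a = p * f b - f b * q by rewrite Dp; ring.
    by apply: gen_idealB => //; apply: gen_idealM.
  have Aqd := gen_ideal_pihomog d Aq.
  have := pihomog_dE hp; rewrite {1}Dp raddfD /= (pihomog_mulr _ _ (hom_f a)).
  case: ifP => [ad <-|_ <-]; last by rewrite add0r.
  apply: gen_idealD => //; rewrite mulrC; apply: gen_idealM.
  apply: (IHd (d - l a)%N); first by have := l_gt0 a; lia.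
    exact: pihomogP.
  have := gen_ideal_pihomog (d - l a + l b) Acb.
  by rewrite (pihomog_mulr _ _ (hom_f b)) leq_addl addnK.
move=> p Apb; apply: gen_ideal_of_pihomog => d.
apply: (homog_case d); first exact: pihomogP.
have := gen_ideal_pihomog (d + l b) Apb.
by rewrite (pihomog_mulr _ _ (hom_f b)) leq_addl addnK.
Qed.

End Homogeneous.

Section RegularSequence.
Variables (K : fieldType) (m n : nat).
Variables (f : 'I_n -> {mpoly K[m]}) (l : 'I_n -> nat).
Hypothesis hom_f : forall i, f i \is (l i).-homog.
Hypothesis l_gt0 : forall i, (0 < l i)%N.
Hypothesis reg_f : regular_sequence [seq f i | i <- enum 'I_n].

Let before i := [set j : 'I_n | (j < i)%N].

Lemma before_succ (i : 'I_n) : before i.+1 = i |: before i.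
Proof. by apply/setP=> j; rewrite !inE -val_eqE /=; lia. Qed.

Lemma regular_sequence_nonzerodivisor (i : 'I_n) :
  nonzerodivisor_mod f (before i) i.
Proof.
have ideal_before p :
    ideal_of (take i [seq f j | j <- enum 'I_n]) p <-> gen_ideal f (before i) p.
  rewrite -map_take; apply: ideal_ofE => j; rewrite inE.
  rewrite -(mem_map val_inj) map_take val_enum_ord take_iota.
  by rewrite mem_iota /=; have := ltn_ord i; lia.
move=> p /ideal_before Ip; apply/ideal_before.
apply: (proj1 reg_f i); first by rewrite size_map size_enum_ord.
by rewrite (nth_map i) ?size_enum_ord // nth_ord_enum.
Qed.

(** A regular sequence of forms of positive degree stays regular under
   permutations and passage to subsequences.  The induction is downward on the
   initial segment contained in $A$.  If the index $a$ that follows this segment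
   is not in $A$, adjoin it: [nonzerodivisor_drop] removes it again when
   $b \ne a$, and when $b = a$ [nonzerodivisor_swap] brings the remaining
   elements of $A$ into the modulus one at a time. *)
Lemma homog_regular_nonzerodivisor (A : {set 'I_n}) b :
  b \notin A -> nonzerodivisor_mod f A b.
Proof.
suff main i : (i <= n)%N -> forall A : {set 'I_n}, before (n - i) \subset A ->
    forall b, b \notin A -> nonzerodivisor_mod f A b.
  move: b; apply: (main n) => //; rewrite subnn.
  by apply/subsetP=> j; rewrite inE.
elim: i => [_ {}A sA {}b Ab|i IHi lt_in {}A sA {}b Ab].
  by case/negP: Ab; apply: (subsetP sA); rewrite inE subn0.
have lt_n : (n - i.+1 < n)%N by lia.
pose a := Ordinal lt_n.
have beforeS : before (n - i) = a |: before a.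
  by rewrite -before_succ /= (_ : (n - i) = (n - i.+1).+1)%N //; lia.
have IH (B : {set 'I_n}) c : before a \subset B -> c \notin a |: B ->
    nonzerodivisor_mod f (a |: B) c.
  move=> sB; apply: IHi; first lia.
  by rewrite beforeS setUS.
have nzd_a (s : seq 'I_n) : a \notin s ->
    nonzerodivisor_mod f ([set c in s] :|: before a) a.
  elim: s => [_|c s IHs]; first by rewrite set_nil set0U;
    apply: regular_sequence_nonzerodivisor.
  rewrite inE negb_or set_cons -setUA => /andP[ne_ac sa].
  case: (boolP (c \in [set c in s] :|: before a)) => [Bc|Bc].
    by rewrite (setUidPr _) ?sub1set //; apply: IHs.
  apply: nonzerodivisor_swap; first exact: IHs.
  by apply: IH; rewrite ?subsetUr // in_setU1 negb_or eq_sym ne_ac.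
case: (boolP (a \in A)) => Aa.
  by rewrite (_ : A = a |: A); [apply: IH; rewrite // (setUidPr _) ?sub1set
    | rewrite (setUidPr _) ?sub1set].
have nzdAa : nonzerodivisor_mod f A a.
  have := nzd_a (enum A); rewrite mem_enum set_enum (setUidPl sA).
  exact.
have [-> //|ne_ba] := eqVneq b a.
apply: nonzerodivisor_drop hom_f l_gt0 _ _ _ nzdAa _.
by apply: IH => //; rewrite in_setU1 negb_or ne_ba.
Qed.

End RegularSequence.

(** * Exactness of mapping cones *)

Section Exactness.
Variable R : comNzRingType.

Definition exact_at (a b c : nat) (A : 'M[R]_(a, b)) (B : 'M[R]_(b, c)) : Prop :=
  forall v : 'cV_b, A *m v = 0 <-> exists w : 'cV_c, v = B *m w.

Lemma mx_solve a b c (A : 'M[R]_(a, b)) (B : 'M[R]_(a, c)) :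
  (forall j, exists v : 'cV_b, A *m v = col j B) ->
  exists X : 'M_(b, c), A *m X = B.
Proof.
move/fin_all_exists => [v Av]; exists (\matrix_(i, j) v j i 0).
apply/matrixP=> i j; have /matrixP/(_ i 0) := Av j; rewrite !mxE => <-.
by apply: eq_bigr => k _; rewrite mxE.
Qed.

Lemma exact_at_mul0 a b c (A : 'M[R]_(a, b)) (B : 'M[R]_(b, c)) :
  exact_at A B -> A *m B = 0.
Proof.
move=> exAB; apply/matrixP=> i j.
have /exAB/matrixP/(_ i 0) : exists w, B *m delta_mx j (0 : 'I_1) = B *m w.
  by exists (delta_mx j 0).
by rewrite -colE colE mulmxA -colE !mxE.
Qed.

(** If $(e, y)$ is a cycle of the cone, then $e = A'e'$ is a boundary, and then
   $y + \phi'e'$ is a cycle of the second complex, hence a boundary too. *)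
Lemma exact_at_cone a b c a' b' c'
    (A : 'M[R]_(a, b)) (A' : 'M[R]_(b, c))
    (B : 'M[R]_(a', b')) (B' : 'M[R]_(b', c'))
    (phi : 'M[R]_(a', b)) (phi' : 'M[R]_(b', c)) :
  exact_at A A' -> exact_at B B' -> B *m phi' = phi *m A' ->
  exact_at (block_mx (- A) 0 phi B) (block_mx (- A') 0 phi' B').
Proof.
move=> exA exB comm v; split=> [|[w ->]]; last first.
  rewrite mulmxA mulmx_block !mul0mx !mulmx0 !addr0 !add0r mulNmx !mulmxN.
  rewrite (exact_at_mul0 exA) (exact_at_mul0 exB) comm addNr !oppr0.
  by rewrite (block_mx0 R a a' c c') mul0mx.
rewrite -[v]vsubmxK; set e := usubmx v; set y := dsubmx v.
rewrite mul_block_col mul0mx addr0 => /(congr1 (fun u => (usubmx u, dsubmx u))).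
rewrite !col_mxKu !col_mxKd linear0 linear0 => -[].
rewrite mulNmx => /eqP; rewrite oppr_eq0 => /eqP/exA[e' De].
rewrite De mulmxA -comm -mulmxA -mulmxDr => /exB[y' Dy].
exists (col_mx (- e') y').
by rewrite mul_block_col mul0mx addr0 mulNmx mulmxN opprK mulmxN -Dy addKr.
Qed.

End Exactness.

Section Resolutions.
Variables (K : fieldType) (m : nat).
Local Notation R := {mpoly K[m]}.
Implicit Types (I : R -> Prop) (F E : gcomplex K m).

Lemma eq_graded_free_resolution F I J :
  (forall p, I p <-> J p) ->
  graded_free_resolution F I -> graded_free_resolution F J.
Proof.
by move=> eqIJ [? ? augF ? ?]; split=> // p; apply: iff_trans (augF p); split=> /eqIJ.
Qed.

Lemma graded_row_mx a b c (d : 'rV[nat]_a) (d1 : 'rV_b) (d2 : 'rV_c)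
    (A : 'M[R]_(a, b)) B :
  graded_mx d d1 A -> graded_mx d d2 B -> graded_mx d (row_mx d1 d2) (row_mx A B).
Proof.
move=> gA gB i j; case: (split_ordP j) => k ->.
  by rewrite !row_mxEl; apply: gA.
by rewrite !row_mxEr; apply: gB.
Qed.

Lemma graded_col_mx a b c (d : 'rV[nat]_a) (d1 : 'rV_b) (d2 : 'rV_c)
    (A : 'M[R]_(b, a)) B :
  graded_mx d1 d A -> graded_mx d2 d B -> graded_mx (row_mx d1 d2) d (col_mx A B).
Proof.
move=> gA gB i j; case: (split_ordP i) => k ->.
  by rewrite col_mxEu row_mxEl; apply: gA.
by rewrite col_mxEd row_mxEr; apply: gB.
Qed.

Lemma graded_mx0 a b (d : 'rV[nat]_a) (d' : 'rV_b) : graded_mx d d' (0 : 'M[R]_(a, b)).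
Proof. by move=> i j; rewrite mxE eqxx. Qed.

Lemma graded_mxN a b (d : 'rV[nat]_a) (d' : 'rV_b) (A : 'M[R]_(a, b)) :
  graded_mx d d' A -> graded_mx d d' (- A).
Proof. by move=> gA i j; rewrite mxE oppr_eq0 dhomogN; apply: gA. Qed.

Lemma graded_mx_twist g a b (d : 'rV[nat]_a) (d' : 'rV_b) (A : 'M[R]_(a, b)) :
  graded_mx d d' A -> graded_mx (map_mx (addn g) d) (map_mx (addn g) d') A.
Proof. by move=> gA i j /gA; rewrite !mxE leq_add2l subnDl. Qed.

Lemma graded_cone_block g a b a' b'
    (dE : 'rV[nat]_a) (dE' : 'rV_b) (dF : 'rV_a') (dF' : 'rV_b')
    (A : 'M[R]_(a, b)) (phi : 'M[R]_(a', b)) (B : 'M[R]_(a', b')) :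
  graded_mx dE dE' A -> graded_mx dF dF' B ->
  graded_mx dF (map_mx (addn g) dE') phi ->
  graded_mx (row_mx (map_mx (addn g) dE) dF) (row_mx (map_mx (addn g) dE') dF')
    (block_mx (- A) 0 phi B).
Proof.
move=> gA gB gphi; rewrite block_mxEh; apply: graded_row_mx; apply: graded_col_mx => //.
  exact/graded_mxN/graded_mx_twist.
exact: graded_mx0.
Qed.

(** Only position 0 of the cone needs the ideal: if $cg$ plus the image of $y$
   is $0$, then $c \in (I : g)$, so $c$ is in the image of the augmentation of $E$.
   From position 1 on the argument is that of [exact_at_cone]. *)
Lemma mapping_cone_resolution (g : R) (d : nat) I E F
    (alpha : forall i, 'M[R]_(rk F i, rk E i)) :
  g \is d.-homog -> graded_free_resolution F I ->
  graded_free_resolution E (colon_ideal I g) -> lifting g d alpha ->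
  graded_free_resolution (mapping_cone g d alpha)
    (fun p => exists c q, I q /\ p = c * g + q).
Proof.
move=> hg [gaF gdF augF exF0 exF] [gaE gdE augE exE0 exE] [lift0 liftS galpha].
have twist0 : const_mx d = map_mx (addn d) (const_mx 0%N) :> 'rV[nat]_1.
  by apply/rowP=> i; rewrite !mxE addn0.
split.
- apply: graded_row_mx => // i j.
  by rewrite !mxE !ord1 mulr1n => _; rewrite leq0n subn0.
- case=> [|i] /=; last exact: graded_cone_block.
  by rewrite twist0; apply: graded_cone_block.
- move=> p; split=> [[c [q [Iq ->]]] | [v]].
    have [v augv] := (augF q).1 Iq; exists (col_mx c%:M v).
    by rewrite /= mul_row_col augv -scalar_mxM -raddfD /= mulrC.
  rewrite -[v]vsubmxK /= mul_row_col [usubmx v]mx11_scalar -scalar_mxM.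
  set c := (_ : 'M_1) 0 0 => /(canRL (addKr _)) augp.
  exists c, (p - c * g); split; last by ring.
  by apply/augF; exists (dsubmx v); rewrite augp addrC -rmorphB /= mulrC.
- move=> v; split=> [|[w ->]]; last first.
    rewrite mulmxA /= mul_row_block mulmx0 add0r.
    rewrite (exact_at_mul0 exF0) lift0 mul_scalar_mx scalerN addNr row_mx0.
    exact: mul0mx.
  rewrite -[v]vsubmxK /= mul_row_col [usubmx v]mx11_scalar -scalar_mxM.
  set c := (_ : 'M_1) 0 0; set y := dsubmx v => /eqP.
  rewrite addr_eq0 => /eqP augy.
  have [e De] : exists e, aug E *m e = c%:M.
    apply/(augE c)/augF; exists (- y).
    by rewrite mulmxN -augy mulrC.
  have /exF0[y' Dy] : aug F *m (y + alpha 0 *m e) = 0.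
    rewrite mulmxDr mulmxA lift0 -scalemxAl De scale_scalar_mx.
    by rewrite augy addrN.
  exists (col_mx (- e) y'); rewrite mul_block_col mul0mx addr0.
  by rewrite mulNmx !mulmxN opprK De -Dy addrCA addNr addr0.
- case=> [|i]; apply: exact_at_cone; try exact: exF; try exact: exE; try exact: exE0.
    exact: liftS.
  exact: liftS.
Qed.

(** The homogeneous component of the right degree of any solution is again a
   solution. *)
Lemma graded_mx_solve a b c (d : 'rV[nat]_a) (d' : 'rV_b) (d'' : 'rV_c)
    (A : 'M[R]_(a, b)) (B : 'M[R]_(a, c)) :
  graded_mx d d' A -> graded_mx d d'' B ->
  (exists X : 'M_(b, c), A *m X = B) ->
  exists X : 'M_(b, c), A *m X = B /\ graded_mx d' d'' X.
Proof.
move=> gA gB [X AX].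
pose Y := \matrix_(i, j) (if (d' ord0 i <= d'' ord0 j)%N
   then pihomog mdeg (d'' ord0 j - d' ord0 i) (X i j) else 0).
exists Y; split; last first.
  move=> i j; rewrite mxE; case: ifP => [_ _|]; last by rewrite eqxx.
  by rewrite pihomogP.
apply/matrixP=> i j.
have [le_dd|lt_dd] := leqP (d ord0 i) (d'' ord0 j); last first.
  have -> : B i j = 0.
    by apply/eqP; apply: contraTT lt_dd => /gB[]; rewrite -leqNgt.
  rewrite mxE big1 // => k _; rewrite mxE.
  have [->|/gA[le_d _]] := eqVneq (A i k) 0; first by rewrite mul0r.
  by case: ifP => [le_d'|]; [lia | rewrite mulr0].
have hB : B i j \is (d'' ord0 j - d ord0 i).-homog.
  by have [->|/gB[]//] := eqVneq (B i j) 0; apply: dhomog0.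
rewrite -(pihomog_dE hB) -AX !mxE raddf_sum; apply: eq_bigr => k _.
rewrite mxE /=; have [->|/gA[le_d hA]] := eqVneq (A i k) 0.
  by rewrite !mul0r pihomog0.
rewrite [in RHS]mulrC (pihomog_mulr _ _ hA) [LHS]mulrC.
have -> : (d' ord0 k - d ord0 i <= d'' ord0 j - d ord0 i)%N
        = (d' ord0 k <= d'' ord0 j)%N by lia.
by case: ifP => le'; rewrite ?mul0r //; congr (pihomog _ _ _ * _); lia.
Qed.

Lemma graded_mulmx a b c (d : 'rV[nat]_a) (d' : 'rV_b) (d'' : 'rV_c)
    (A : 'M[R]_(a, b)) (B : 'M[R]_(b, c)) :
  graded_mx d d' A -> graded_mx d' d'' B -> graded_mx d d'' (A *m B).
Proof.
move=> gA gB i j; rewrite mxE => nzAB.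
have term_hom k : A i k * B k j != 0 ->
    (d ord0 i <= d'' ord0 j)%N /\ A i k * B k j \is (d'' ord0 j - d ord0 i).-homog.
  rewrite mulf_eq0 negb_or => /andP[/gA[le_d hA] /gB[le_d' hB]].
  split; first exact: leq_trans le_d'.
  have -> : (d'' ord0 j - d ord0 i = d' ord0 k - d ord0 i + (d'' ord0 j - d' ord0 k))%N.
    by lia.
  exact: dhomogM.
split.
  apply: contraNT nzAB => gt_d; rewrite big1 // => k _.
  by apply/eqP; apply: contraNT gt_d => /term_hom[].
apply: rpred_sum => k _; have [->|/term_hom[]//] := eqVneq (A i k * B k j) 0.
exact: dhomog0.
Qed.

Definition cycle F i : 'cV[R]_(rk F i) -> Prop :=
  match i with
  | 0 => fun v => aug F *m v = 0
  | i'.+1 => fun v => dif F i' *m v = 0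
  end.

Lemma resolution_cycle F I i (v : 'cV_(rk F i)) :
  graded_free_resolution F I -> cycle v -> exists w, v = dif F i *m w.
Proof. by case=> _ _ _ exF0 exF; case: i v => [|i] v; [move/exF0 | move/exF]. Qed.

(** The comparison theorem: as $E$ is free and $F$ exact, a lifting is built one
   position at a time, the composite with the differential of $E$ being a cycle
   at each stage. *)
Lemma lifting_exists (g : R) (d : nat) I J E F :
  g \is d.-homog -> (forall p, J p -> I (p * g)) ->
  graded_free_resolution F I -> graded_free_resolution E J ->
  exists alpha : forall i, 'M[R]_(rk F i, rk E i), lifting g d alpha.
Proof.
move=> hg gJI resF [gaE gdE augE exE0 exE].
have [gaF gdF augF _ _] := resF.
pose graded i (X : 'M[R]_(rk F i, rk E i)) :=
  graded_mx (dg F i) (map_mx (addn d) (dg E i)) X.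
pose liftable i (X : 'M[R]_(rk F i, rk E i)) :=
  graded i X /\ forall v, cycle (X *m (dif E i *m v)).
have [X0 [X0g X0gr]] : exists X, aug F *m X = g *: aug E /\ graded 0%N X.
  apply: graded_mx_solve gaF _ _ => [i j|].
    rewrite !mxE mulf_eq0 negb_or => /andP[_ /gaE[]]; rewrite !mxE leq0n !subn0 => _ hE.
    by split; rewrite // dhomogM.
  apply: mx_solve => j.
  have /gJI/augF[v Dv] : J (aug E 0 j).
    apply/augE; exists (delta_mx j 0); rewrite -colE [col _ _]mx11_scalar.
    by rewrite mxE.
  exists v; rewrite Dv; apply/matrixP=> i k; rewrite !mxE !ord1 eqxx mulr1n.
  exact: mulrC.
have X0lift : liftable 0%N X0.
  split=> // v; rewrite /= !mulmxA X0g -scalemxAl (exact_at_mul0 exE0).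
  by rewrite scaler0 mul0mx.
have step i (X : {X | liftable i X}) :
    {Y : {Y | liftable i.+1 Y} | dif F i *m sval Y = sval X *m dif E i}.
  apply: constructive_indefinite_description.
  case: X => X [Xgr Xlift] /=.
  have [Y [XY Ygr]] : exists Y, dif F i *m Y = X *m dif E i /\ graded i.+1 Y.
    apply: graded_mx_solve (gdF i) _ _.
      by apply: graded_mulmx Xgr _; apply: graded_mx_twist.
    apply: mx_solve => j.
    have [|w Dw] := resolution_cycle (v := X *m (dif E i *m delta_mx j 0)) resF.
      exact: Xlift.
    by exists w; rewrite -Dw mulmxA -colE.
  have Ylift : liftable i.+1 Y.
    split=> // v; rewrite /= mulmxA XY -mulmxA [dif E i *m _]mulmxA.
    by rewrite (exact_at_mul0 (exE i)) mul0mx mulmx0.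
  by exists (exist _ Y Ylift).
(* the recursion carries the property that makes the next stage possible *)
pose fix alpha i : {X | liftable i X} :=
  if i is i'.+1 then sval (step i' (alpha i')) else exist _ X0 X0lift.
exists (fun i => sval (alpha i)); split=> // i.
  exact: svalP (step i (alpha i)).
exact: (svalP (alpha i)).1.
Qed.

End Resolutions.

(** * Subset counts *)

Section SubsetCount.
Variables (I : finType) (l : I -> nat).
Implicit Types (A B S T : {set I}) (P : pred nat).

(** The multiplicities, tested by $P$, of the sums of $l$ over the $h$-subsets of
   $A$.  Lists of shifts are compared up to permutation through such counts. *)
Definition subset_count A h P : nat :=
  (\sum_(S : {set I} | (S \subset A) && (#|S| == h)) P (\sum_(i in S) l i))%N.

Lemma subset_count0 A P : subset_count A 0 P = P 0%N.
Proof.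
rewrite /subset_count (big_pred1 set0) ?big_set0 // => S /=.
by rewrite cards_eq0 andb_idl // => /eqP->; apply: sub0set.
Qed.

Lemma subset_count_set0 h P : subset_count set0 h.+1 P = 0%N.
Proof.
by rewrite /subset_count big1 // => S; rewrite subset0 => /andP[/eqP->]; rewrite cards0.
Qed.

(** The bijection $S \mapsto B \cup S$. *)
Lemma subset_count_shift A B h P : [disjoint A & B] ->
  subset_count A h (P \o addn (\sum_(i in B) l i)) =
  (\sum_(T : {set I} | [&& B \subset T, T \subset A :|: B & #|T| == h + #|B|])
     P (\sum_(i in T) l i))%N.
Proof.
move=> dAB; rewrite (reindex_onto (fun S => B :|: S) (fun T => T :\: B)) /=;
  last first.
  by move=> T /and3P[sBT _ _]; rewrite -{1}(setIidPr sBT) setID.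
have sub_disj S : S \subset A -> [disjoint B & S].
  by move=> sSA; rewrite disjoint_sym; apply: disjointWl dAB.
rewrite /subset_count; apply: eq_big => S.
  rewrite subsetUl /=; apply/andP/andP => -[].
    move=> sSA /eqP cS; have dBS := sub_disj S sSA.
    rewrite cardsU (disjoint_setI0 dBS) cards0 cS subn0 addnC eqxx andbT.
    rewrite setUC setSU // setUC setDUl setDv set0U; split=> //.
    by apply/eqP/setDidPl; rewrite disjoint_sym.
  case/andP=> sST cS /eqP DS.
  have dSB : [disjoint S & B] by rewrite -DS -setI_eq0 setIDAC setDIl setDv setI0.
  split.
    rewrite -DS setDUl setDv set0U; apply/subsetP=> i /setDP[Si nBi].
    by have := subsetP sST i; rewrite !inE Si orbT (negPf nBi) orbF; apply.
  by rewrite cardsU setIC (disjoint_setI0 dSB) cards0 subn0 addnC eqn_add2r in cS.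
case/andP=> sSA _; have dBS := sub_disj S sSA.
by rewrite /= [in RHS](eq_bigl [predU B & S]) ?bigU // => i; rewrite !inE.
Qed.

Lemma subset_countU1 a A h P : a \notin A ->
  subset_count (a |: A) h.+1 P =
  (subset_count A h (P \o addn (l a)) + subset_count A h.+1 P)%N.
Proof.
move=> Aa; have dAa : [disjoint A & [set a]] by rewrite disjoint_sym disjoints1.
have := subset_count_shift h P dAa; rewrite big_set1 => ->.
rewrite {1}/subset_count (bigID (fun S => a \in S)) /=; congr addn; apply: eq_bigl => S.
  by rewrite sub1set setUC cards1 addn1 andbC.
by rewrite setUC andbAC -subsetD1 setUC setU1K.
Qed.

End SubsetCount.

Section Shifts.
Variables (K : fieldType) (m : nat).
Local Notation R := {mpoly K[m]}.
Implicit Types (F E : gcomplex K m) (P : pred nat).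

Lemma count_shifts F h P :
  count P (shifts F h) = (\sum_(a < rk F h) P (dg F h ord0 a))%N.
Proof. by rewrite -sum1_count big_map big_enum_cond /= big_mkcond. Qed.

Lemma count_shifts_cone0 g d E F (alpha : forall i, 'M[R]_(rk F i, rk E i)) P :
  count P (shifts (mapping_cone g d alpha) 0) = (P d + count P (shifts F 0))%N.
Proof.
rewrite !count_shifts big_split_ord big_ord1 /= row_mxEl mxE.
by congr addn; apply: eq_bigr => i _; rewrite row_mxEr.
Qed.

Lemma count_shifts_coneS g d E F (alpha : forall i, 'M[R]_(rk F i, rk E i)) h P :
  count P (shifts (mapping_cone g d alpha) h.+1) =
  (count (P \o addn d) (shifts E h) + count P (shifts F h.+1))%N.
Proof.
rewrite !count_shifts big_split_ord /=.
by congr addn; apply: eq_bigr => i _; rewrite ?row_mxEr // row_mxEl mxE.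
Qed.

End Shifts.

(** * Koszul complexes *)

Section Koszul.
Variables (K : fieldType) (m : nat).
Local Notation R := {mpoly K[m]}.

Lemma zero_complex_resolution :
  graded_free_resolution (zero_complex K m) (fun p => p = 0).
Proof.
split.
- by move=> i [].
- by move=> i [].
- move=> p; split=> [->|[v]]; first by exists 0; rewrite mulmx0 raddf0.
  by rewrite mul0mx => /(congr1 (fun M : 'M_1 => M 0 0)); rewrite !mxE.
- by move=> v; split=> _; [exists 0; apply/matrixP=> -[] | rewrite mul0mx].
- by move=> i v; split=> _; [exists 0; apply/matrixP=> -[] | apply: mul0mx].
Qed.

Lemma principal_complex_resolution (g : R) d :
  g != 0 -> g \is d.-homog ->
  graded_free_resolution (principal_complex g d) (fun p => exists c, p = c * g).
Proof.
move=> nz_g hg; split.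
- by move=> i j; rewrite !mxE !ord1 mulr1n subn0.
- by move=> i ? [].
- move=> p; split=> [[c ->] | [v]].
    by exists c%:M; rewrite /= -scalar_mxM mulrC.
  rewrite /= mul_scalar_mx => /(congr1 (fun M : 'M_1 => M 0 0)).
  by rewrite !mxE eqxx mulr1n => <-; exists (v 0 0); rewrite mulrC.
- move=> v; rewrite /= mul_scalar_mx; split=> [|[w ->]]; last by rewrite mul0mx scaler0.
  move=> /eqP; rewrite scalemx_eq0 (negPf nz_g) => /eqP->.
  by exists 0; rewrite mul0mx.
- by move=> i v; split=> _; [exists 0; apply/matrixP=> -[] | apply: mul0mx].
Qed.

Definition irrelevant_mx a b (A : 'M[R]_(a, b)) : Prop :=
  forall i j, (A i j)@_0%MM = 0.

Lemma irrelevant_row_mx a b c (A : 'M_(a, b)) (B : 'M_(a, c)) :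
  irrelevant_mx A -> irrelevant_mx B -> irrelevant_mx (row_mx A B).
Proof. by move=> irA irB i j; rewrite mxE; case: splitP => k _. Qed.

Lemma irrelevant_col_mx a b c (A : 'M_(b, a)) (B : 'M_(c, a)) :
  irrelevant_mx A -> irrelevant_mx B -> irrelevant_mx (col_mx A B).
Proof. by move=> irA irB i j; rewrite mxE; case: splitP => k _. Qed.

Lemma irrelevant_mx0 a b : irrelevant_mx (0 : 'M_(a, b)).
Proof. by move=> i j; rewrite mxE mcoeff0. Qed.

Lemma irrelevant_mxN a b (A : 'M_(a, b)) : irrelevant_mx A -> irrelevant_mx (- A).
Proof. by move=> irA i j; rewrite mxE mcoeffN irA oppr0. Qed.

Lemma irrelevant_scalar_mx a (p : R) : p@_0%MM = 0 -> irrelevant_mx (p%:M : 'M_a).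
Proof. by move=> p0 i j; rewrite mxE mcoeffMn p0 mul0rn. Qed.

Lemma homog_mcoeff0 (p : R) d : (0 < d)%N -> p \is d.-homog -> p@_0%MM = 0.
Proof. by move=> d_gt0 /dhomog_nemf_coeff; apply; rewrite /= mdeg0 eq_sym -lt0n. Qed.

Variables (I : finType) (f : I -> R) (l : I -> nat).
Hypothesis hom_f : forall i, f i \is (l i).-homog.

Let kos (s : seq I) := koszul [seq (f i, l i) | i <- s].

Lemma koszul_minimal (s : seq I) :
  (forall i, (0 < l i)%N) -> minimal_complex (kos s).
Proof.
move=> l_gt0.
suff: irrelevant_mx (aug (kos s)) /\ minimal_complex (kos s) by case.
have f0 i : (f i)@_0%MM = 0 := homog_mcoeff0 (l_gt0 i) (hom_f i).
elim: s => [|i s [aug0 dif0]]; first by split=> [|j] a [].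
split; first by apply: irrelevant_row_mx; [apply: irrelevant_scalar_mx|].
case=> [|j]; rewrite /= block_mxEh; apply: irrelevant_row_mx;
  apply: irrelevant_col_mx; do ?[exact: irrelevant_mx0 | exact: irrelevant_scalar_mx
    | exact/irrelevant_mxN | exact/irrelevant_mxN/dif0 | exact: dif0].
Qed.

Lemma count_shifts_koszul (s : seq I) h P : uniq s ->
  count P (shifts (kos s) h) = subset_count l [set i in s] h.+1 P.
Proof.
elim: s h P => [|i s IHs] h P.
  by rewrite set_nil subset_count_set0 count_shifts big_ord0.
rewrite /= => /andP[si us]; rewrite set_cons subset_countU1 ?inE //.
case: h => [|h]; rewrite ?count_shifts_cone0 ?count_shifts_coneS !IHs //.
by rewrite subset_count0 /= addn0.
Qed.

Hypothesis nzd_f : forall (A : {set I}) b, b \notin A -> nonzerodivisor_mod f A b.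

(** Each step of the tensor product construction is the mapping cone of a
   lifting: $f_i$ acts on the whole Koszul complex of $s$ as a scalar, and
   $((f_j)_{j \in s} : f_i) = (f_j)_{j \in s}$. *)
Lemma koszul_resolution (s : seq I) : uniq s ->
  graded_free_resolution (kos s) (gen_ideal f [set i in s]).
Proof.
elim: s => [_|i s IHs].
  apply: eq_graded_free_resolution zero_complex_resolution => p.
  by rewrite /gen_ideal set_nil; split=> [->|[c ->]];
    [exists (fun=> 0)|]; rewrite big_set0.
rewrite /= => /andP[si /IHs{}IHs].
apply: eq_graded_free_resolution (mapping_cone_resolution (hom_f i) IHs _ _).
- by move=> p; rewrite set_cons; apply: iff_sym (gen_idealU1 _ _ _ _).
- apply: eq_graded_free_resolution IHs => p; split=> [Ip|].
    by rewrite /colon_ideal mulrC; apply: gen_idealM.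
  by apply: nzd_f; rewrite inE.
- split=> [|j|j a b]; first by rewrite mul_mx_scalar.
    by rewrite mul_mx_scalar mul_scalar_mx.
  rewrite !mxE; have [->|ne_ab] := eqVneq a b; last by rewrite mulr0n eqxx.
  by rewrite leq_addl addnK mulr1n.
Qed.

End Koszul.

(** * The order of the steps *)

Section Steps.
Variable n : nat.
Implicit Types (p q : 'I_n * 'I_n) (k j : 'I_n).

(** Decreasing lexicographic order: a product precedes another one in the
   procedure exactly when this holds. *)
Definition before_step p q : bool :=
  (q.1 < p.1)%N || (p.1 == q.1) && (q.2 < p.2)%N.

Lemma mem_steps p : (p \in steps n) = (p.1 < p.2)%N.
Proof.
case: p => k j; apply/allpairsPdep/idP => [[k' [j' [_ +]]]|lt_kj].
  by rewrite mem_rev mem_filter => /andP[lt_kj _] [-> ->].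
exists k, j; split; rewrite ?mem_rev ?mem_enum //.
by rewrite mem_filter mem_enum andbT.
Qed.

Lemma pairwise_lex (T U : eqType) (r : rel T) (r' : rel U) s (t : T -> seq U) :
  pairwise r s -> (forall x, pairwise r' (t x)) ->
  pairwise (fun p q : T * U => r p.1 q.1 || (p.1 == q.1) && r' p.2 q.2)
    [seq (x, y) | x <- s, y <- t x].
Proof.
move=> + rt; elim: s => //= x s IHs /andP[/allP rx rs].
rewrite pairwise_cat IHs // andbT; apply/andP; split.
  apply/allrelP=> _ _ /mapP[y _ ->] /allpairsPdep[x' [y' [sx' _ ->]]].
  by rewrite /= rx.
rewrite pairwise_map; apply: sub_pairwise (rt x) => y y' /= ryy'.
by rewrite eqxx ryy' orbT.
Qed.

Lemma steps_pairwise : pairwise before_step (steps n).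
Proof.
have gt_trans : transitive (fun i j : 'I_n => j < i)%N.
  by move=> j i k ij jk; apply: ltn_trans ij.
have lt_enum : sorted (fun i j : 'I_n => i < j)%N (enum 'I_n).
  by have := iota_ltn_sorted 0 n; rewrite -val_enum_ord sorted_map.
apply: (pairwise_lex (r := fun i j : 'I_n => (j < i)%N)
                     (r' := fun i j : 'I_n => (j < i)%N)) => [|k].
  by rewrite -sorted_pairwise // rev_sorted.
rewrite -sorted_pairwise // rev_sorted; apply: sorted_filter lt_enum.
by move=> j i k' ij jk; apply: ltn_trans jk.
Qed.

Lemma steps_split s p r : steps n = s ++ p :: r ->
  (p.1 < p.2)%N /\ forall q, (q \in s) = (q.1 < q.2)%N && before_step q p.
Proof.
move=> Dsteps; split; first by rewrite -mem_steps Dsteps mem_cat mem_head orbT.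
have := steps_pairwise; rewrite Dsteps pairwise_cat => /and3P[sr _ /= /andP[pr _]].
move=> q; rewrite -mem_steps Dsteps mem_cat inE.
case: (boolP (q \in s)) => [sq|_] /=.
  by symmetry; apply: (allrelP sr); rewrite // mem_head.
have [->|_] := eqVneq q p.
  by rewrite /before_step !ltnn andbF.
case: (boolP (q \in r)) => //= rq.
by have := allP pr q rq; rewrite /before_step -!val_eqE /=; lia.
Qed.

Lemma steps_uniq : uniq (steps n).
Proof.
by apply: pairwise_uniq steps_pairwise => p; rewrite /before_step !ltnn andbF.
Qed.

End Steps.

(** * The iterated cone *)

Section IteratedConeTheory.
Variables (K : fieldType) (m n : nat).
Local Notation R := {mpoly K[m]}.
Variables (f : 'I_n -> R) (l : 'I_n -> nat).
Hypothesis hom_f : forall i, f i \is (l i).-homog.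
Hypothesis nzd_f : forall (A : {set 'I_n}) b, b \notin A -> nonzerodivisor_mod f A b.

Let prod2 (p : 'I_n * 'I_n) := f p.1 * f p.2.

Definition colon_set (k j : 'I_n) : {set 'I_n} :=
  [set i : 'I_n | (k < i)%N && (i != j)].

Lemma colon_setE k j : [set i in colon_indices k j] = colon_set k j.
Proof. by apply/setP=> i; rewrite !inE mem_filter mem_enum andbT. Qed.

Lemma ideal_of_products s p :
  ideal_of (products f s) p <-> gen_ideal prod2 [set q in s] p.
Proof. by apply: ideal_ofE => q; rewrite inE. Qed.

(** All generators of $I'$ lie in the ideal generated by the $f_i$ with $i > k$,
   $i \ne j$, and neither $f_k$ nor $f_j$ divides zero modulo that ideal. *)
Lemma colon_products s k j r : steps n = s ++ (k, j) :: r -> forall p,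
  colon_ideal (ideal_of (products f s)) (f k * f j) p <->
  gen_ideal f (colon_set k j) p.
Proof.
move=> /steps_split[/= lt_kj mem_s] p; rewrite /colon_ideal; split.
  move=> /ideal_of_products[c Dp].
  have: gen_ideal f (colon_set k j) (p * f j * f k).
    rewrite -mulrA [f j * _]mulrC Dp; apply: gen_ideal_sum => -[a b].
    rewrite inE mem_s /before_step /= -!val_eqE /= => lt_ab; apply: gen_idealM.
    have [Db|ne_bj] := eqVneq b j.
      rewrite /prod2 mulrC; apply/gen_idealM/gen_ideal_gen.
      by rewrite inE -!val_eqE /=; move: lt_ab; rewrite Db; lia.
    apply/gen_idealM/gen_ideal_gen.
    by rewrite inE ne_bj /=; move: lt_ab lt_kj; lia.
  by move=> /nzd_f/nzd_f; apply; rewrite inE ?eqxx ?andbF ?ltnn.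
move=> [c ->]; apply/ideal_of_products; rewrite mulr_suml.
apply: gen_ideal_sum => i; rewrite inE -val_eqE => /andP[lt_ki ne_ij].
have [lt_ji|le_ij] := ltnP j i.
  rewrite (_ : _ * _ = c i * f j * prod2 (k, i)); last by rewrite /prod2 /=; ring.
  apply/gen_idealM/gen_ideal_gen.
  by rewrite inE mem_s /before_step /= lt_ki eqxx lt_ji orbT.
have lt_ij : (i < j)%N by move: ne_ij => /=; lia.
rewrite (_ : _ * _ = c i * f k * prod2 (i, j)); last by rewrite /prod2 /=; ring.
by apply/gen_idealM/gen_ideal_gen; rewrite inE mem_s /before_step /= lt_ki lt_ij.
Qed.

Lemma colon_koszul_resolution k j :
  graded_free_resolution (colon_koszul f l k j) (gen_ideal f (colon_set k j)).
Proof.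
rewrite -colon_setE; apply: koszul_resolution => //.
by rewrite filter_uniq ?enum_uniq.
Qed.

Lemma nonzerodivisor_neq0 i : f i != 0.
Proof.
apply/eqP=> fi0; have : gen_ideal f set0 1.
  by apply: (nzd_f (b := i)); rewrite ?inE // fi0 mulr0; apply: gen_ideal0.
by case=> c /eqP; rewrite big_set0 oner_eq0.
Qed.

Lemma iterated_cone_resolution s F : iterated_cone f l s F ->
  forall r, steps n = s ++ r -> graded_free_resolution F (ideal_of (products f s)).
Proof.
elim=> [k j|{}s k j {}F alpha _ IHF lift_alpha] r Dsteps.
  apply: eq_graded_free_resolution (principal_complex_resolution _ _).
  - move=> p; rewrite ideal_of_products set_cons set_nil; split=> [[c ->]|].
      by apply/gen_idealU1; exists c, 0; rewrite addr0; split=> //; apply: gen_ideal0.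
    by move=> /gen_idealU1[c [q [[e ->] ->]]]; exists c; rewrite big_set0 addr0.
  - by rewrite mulf_neq0 ?nonzerodivisor_neq0.
  - exact: dhomogM.
rewrite cat_rcons in Dsteps.
apply: eq_graded_free_resolution
  (mapping_cone_resolution (dhomogM (hom_f k) (hom_f j)) (IHF _ Dsteps) _
     lift_alpha).
- move=> p; rewrite ideal_of_products.
  have -> : [set q in rcons s (k, j)] = (k, j) |: [set q in s].
    by apply/setP=> q; rewrite !inE mem_rcons inE.
  rewrite gen_idealU1; split=> -[c [q [Iq Dp]]]; exists c, q; split=> //;
    exact/ideal_of_products.
- apply: eq_graded_free_resolution (colon_koszul_resolution k j) => p.
  exact: iff_sym (colon_products Dsteps p).
Qed.

Lemma iterated_cone_lifting s k j r F :
  steps n = s ++ (k, j) :: r -> iterated_cone f l s F ->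
  exists alpha : forall i, 'M_(rk F i, rk (colon_koszul f l k j) i),
    lifting (f k * f j) (l k + l j) alpha.
Proof.
move=> Dsteps itF; have resF := iterated_cone_resolution itF Dsteps.
apply: lifting_exists resF (colon_koszul_resolution k j); first exact: dhomogM.
by move=> p /(colon_products Dsteps).
Qed.

Lemma iterated_cone_exists s r : s <> [::] -> steps n = s ++ r ->
  exists F, iterated_cone f l s F.
Proof.
elim/last_ind: s r => // s [k j] IHs r _ Dsteps.
have [->|/eqP nz_s] := eqVneq s [::].
  by eexists; apply: iterated_cone_start.
rewrite cat_rcons in Dsteps; have [F itF] := IHs _ nz_s Dsteps.
have [alpha lift_alpha] := iterated_cone_lifting Dsteps itF.
by eexists; apply: iterated_cone_step lift_alpha.
Qed.

(** Adding $f_kf_j$ contributes in position $h$ one summand for every $h$-subset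
   of the colon set; for the first product the colon set is empty. *)
Lemma count_shifts_iterated_cone s F : iterated_cone f l s F ->
  forall r, steps n = s ++ r -> forall h P,
  count P (shifts F h) =
    (\sum_(p <- s) subset_count l (colon_set p.1 p.2) h (P \o addn (l p.1 + l p.2)))%N.
Proof.
elim=> [k j|{}s k j {}F alpha _ IHF _] r Dsteps h P.
  rewrite big_seq1 count_shifts /=.
  have [lt_kj mem_s] := steps_split (s := [::]) Dsteps.
  have -> : colon_set k j = set0.
    apply/setP=> i; rewrite !inE; apply/negP=> /andP[lt_ki ne_ij].
    have := mem_s (i, j); have := mem_s (j, i).
    rewrite /before_step /= in lt_kj *; rewrite !in_nil lt_ki lt_kj !andbT.
    by rewrite -val_eqE /= in ne_ij *; lia.
  case: h => [|h]; last by rewrite subset_count_set0 big_ord0.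
  by rewrite subset_count0 big_ord1 mxE /= addn0.
rewrite cat_rcons in Dsteps.
rewrite -cats1 big_cat big_seq1 /= -(IHF _ Dsteps) [RHS]addnC.
have uC : uniq (colon_indices k j) by rewrite filter_uniq ?enum_uniq.
case: h => [|h].
  by rewrite count_shifts_cone0 subset_count0 /= addn0.
by rewrite count_shifts_coneS count_shifts_koszul // colon_setE.
Qed.

Lemma count_expected_shifts h P :
  count P (expected_shifts l h) =
  (\sum_(A : {set 'I_n} | #|A| == h.+2) h.+1 * P (\sum_(i in A) l i))%N.
Proof.
rewrite count_flatten -map_comp sumnE big_map big_enum_cond /=.
apply: eq_big => [A|A _]; first by rewrite inE andbT.
exact: etrans (count_nseq P h.+1 _) (mulnC _ _).
Qed.

(** An $(h+2)$-set $A$ arises from the pairs $(k, j)$ with $k = \min A$ and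
   $j \in A \setminus \{k\}$, of which there are $h+1$. *)
Lemma sum_colon_subset_count h P :
  (\sum_(p <- steps n)
     subset_count l (colon_set p.1 p.2) h (P \o addn (l p.1 + l p.2)))%N =
  (\sum_(A : {set 'I_n} | #|A| == h.+2) h.+1 * P (\sum_(i in A) l i))%N.
Proof.
pose arises (p : 'I_n * 'I_n) (A : {set 'I_n}) :=
  [&& p.1 \in A, p.2 \in A, (p.1 < p.2)%N & [forall i in A, (p.1 <= i)%N]].
transitivity (\sum_(p <- steps n)
    \sum_(A : {set 'I_n} | (#|A| == h.+2) && arises p A) P (\sum_(i in A) l i))%N.
  apply: eq_big_seq => -[k j]; rewrite mem_steps /= => lt_kj.
  have ne_kj : k != j by rewrite -val_eqE /=; lia.
  have dis : [disjoint colon_set k j & [set k; j]].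
    rewrite disjoint_sym -setI_eq0; apply/eqP/setP=> i; rewrite !inE.
    by case: eqP => [->|_]; rewrite ?ltnn //=; case: eqP => //=; rewrite andbF.
  have -> : (l k + l j = \sum_(i in [set k; j]) l i)%N.
    by rewrite big_setU1 ?inE //= big_set1.
  rewrite subset_count_shift //; apply: eq_bigl => A.
  rewrite cards2 ne_kj addn2 /arises /= lt_kj subUset !sub1set.
  have [kA|] := boolP (k \in A); last by rewrite andbF.
  have [jA|] := boolP (j \in A); last by rewrite !andbF.
  rewrite /= andbC; congr andb; apply/subsetP/forall_inP => sA i iA.
    by have := sA i iA; rewrite !inE; case: eqP => [->|_] //=; case: eqP => [->|_] /=; lia.
  rewrite !inE; have := sA i iA; have [->|ne_ik] := eqVneq i k; first by rewrite orbT.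
  by move: ne_ik; rewrite -val_eqE /=; case: (i == j) => //=; lia.
rewrite big_uniq ?steps_uniq //.
rewrite (exchange_big_dep (fun A : {set 'I_n} => #|A| == h.+2)) /=.
  apply: eq_bigr => A cA; rewrite sum_nat_cond_const; congr (_ * _)%N.
  have [a0 a0A] : exists a, a \in A by apply/card_gt0P; rewrite (eqP cA).
  have [k kA k_min] : exists2 k, k \in A & forall i, i \in A -> (k <= i)%N.
    by case: (arg_minnP (fun i : 'I_n => val i) a0A) => k kA k_min; exists k.
  have -> : [set p in steps n | (#|A| == h.+2) && arises p A] = setX [set k] (A :\ k).
    apply/setP=> -[k' j]; rewrite !inE mem_steps cA /arises /= -!val_eqE /=.
    apply/idP/idP => [/and5P[lt_kj k'A jA _ /forall_inP k'_min]|].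
      by rewrite jA andbT; have := k_min k' k'A; have := k'_min k kA; lia.
    case/and3P=> /eqP/val_inj-> ne_jk jA; have := k_min j jA.
    rewrite kA jA /=; have -> : [forall i in A, (k <= i)%N] by apply/forall_inP.
    by lia.
  by rewrite cardsX cards1 mul1n; have := cardsD1 k A; rewrite kA (eqP cA) => -[].
by move=> p A _ /andP[].
Qed.

Lemma shifts_iterated_cone F h : iterated_cone f l (steps n) F ->
  perm_eq (shifts F h) (expected_shifts l h).
Proof.
move=> itF; apply/permP => P; rewrite count_expected_shifts -sum_colon_subset_count.
by apply: (count_shifts_iterated_cone itF (r := [::])); rewrite cats0.
Qed.

Lemma rk_iterated_cone F h : iterated_cone f l (steps n) F ->
  (n - 2 < h)%N -> rk F h = 0%N.
Proof.
move=> itF lt_h; have := perm_size (shifts_iterated_cone h itF).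
rewrite size_image card_ord => ->; rewrite -count_predT count_expected_shifts.
rewrite big1 // => A /eqP cA; have := max_card A; rewrite cA card_ord.
by lia.
Qed.

End IteratedConeTheory.

Theorem theorem6p3 (K : fieldType) (n : nat)
    (f : 'I_n -> {mpoly K[n.+1]}) (l : 'I_n -> nat)
    (hK : infinite_type K) (hn : (2 <= n)%N)
    (hl : forall i, (1 <= l i)%N)
    (hhom : forall i, f i \is (l i).-homog)
    (hreg : regular_sequence [seq f i | i <- enum 'I_n]) :
  let Omega :=
    ideal_of [seq f p.1 * f p.2 | p in [pred p : 'I_n * 'I_n | (p.1 < p.2)%N]] in
  (* the procedure can be carried out, *)
  (exists F, iterated_cone f l (steps n) F) /\
  (* it yields, whatever the liftings, a resolution with the stated modules, *)
  (forall F, iterated_cone f l (steps n) F ->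
    [/\ graded_free_resolution F Omega,
        forall h, (h <= n - 2)%N -> perm_eq (shifts F h) (expected_shifts l h)
      & forall h, (n - 2 < h)%N -> rk F h = 0%N]) /\
  (* and each of its steps is as described. *)
  (forall s k j r, s <> [::] -> steps n = s ++ (k, j) :: r ->
    let I' := ideal_of (products f s) in
    let g := f k * f j in
    let E := colon_koszul f l k j in
    [/\ forall p, colon_ideal I' g p <->
          ideal_of [seq f i | i <- colon_indices k j] p,
        graded_free_resolution E (colon_ideal I' g),
        minimal_complex E
      & forall F', iterated_cone f l s F' ->
          graded_free_resolution F' I' /\
          exists alpha : forall i, 'M_(rk F' i, rk E i),
            lifting g (l k + l j) alpha]).
Proof.
move=> Omega.
have l_gt0 i : (0 < l i)%N := hl i.
have nzd_f := homog_regular_nonzerodivisor hhom l_gt0 hreg.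
have steps_all : steps n = steps n ++ [::] by rewrite cats0.
have steps_neq_nil : steps n <> [::].
  have lt0n : (0 < n)%N := ltnW hn.
  move=> steps0; have : (Ordinal lt0n, Ordinal hn) \in steps n by rewrite mem_steps.
  by rewrite steps0.
split; first exact: (iterated_cone_exists hhom nzd_f steps_neq_nil steps_all).
split=> [F itF | s k j r _ Dsteps I' g E].
  split=> [|h _|h]; last exact: (rk_iterated_cone itF).
    apply: eq_graded_free_resolution
      (iterated_cone_resolution hhom nzd_f itF steps_all).
    move=> p; apply: iff_trans (ideal_of_products _ _ _) _.
    apply: iff_sym; apply: ideal_ofE => q.
    by rewrite mem_enum [RHS]inE mem_steps.
  exact: shifts_iterated_cone itF.
have colonE := colon_products nzd_f Dsteps.
split.
- move=> p; apply: iff_trans (colonE p) _; rewrite -colon_setE.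
  by apply: iff_sym; apply: ideal_ofE => i; rewrite inE.
- apply: eq_graded_free_resolution (colon_koszul_resolution hhom nzd_f k j) => p.
  exact: iff_sym (colonE p).
- exact: koszul_minimal.
- move=> F' itF'; split; first exact: (iterated_cone_resolution hhom nzd_f itF' Dsteps).
  exact: (iterated_cone_lifting hhom nzd_f Dsteps itF').
Qed.
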